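(* For every nonnegative integer $\ell$, every nonnegative integer $n$ and every complex number $x$, $$\sum_{k=0}^n (q^{-3n};q^3)_k \left[\begin{matrix} x,\ q^{2-\ell}/x\\ q,\ -q,\ q^{3/2},\ -q^{3/2-\ell},\ q^{-1-3n}\end{matrix}\middle| q\right]_k q^k = \left[\begin{matrix} xq^{-1},\ -xq^{-1/2}\\ x^2q^{-1},\ -q^{-1/2}\end{matrix}\middle|q\right]_\ell \sum_{i=0}^{\ell}(-1)^i q^{(\ell-\frac12)i}\,\frac{1-x^2q^{2i-2}}{1-x^2q^{-2}}\left[\begin{matrix} q^{-\ell},\ x,\ x^2q^{-2}\\ q,\ xq^{-1},\ x^2q^{\ell-1}\end{matrix}\middle|q\right]_i\left[\begin{matrix} q^{2+i}x,\ q^{4-i}/x\\ q^2,\ q^4\end{matrix}\middle|q^3\right]_n.$$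
   Context: $q$ is a complex number with a fixed square root $q^{1/2}$, and $q^{r/2}$ means $(q^{1/2})^r$. For a complex number $a$, a base $p$ and a nonnegative integer $m$, $(a;p)_m=\prod_{j=0}^{m-1}(1-ap^j)$ with $(a;p)_0=1$. The bracket notation means $\left[\begin{matrix} a_1,\dots,a_r\\ b_1,\dots,b_s\end{matrix}\middle|p\right]_m=\frac{(a_1;p)_m\cdots(a_r;p)_m}{(b_1;p)_m\cdots(b_s;p)_m}$ (used with $p=q$ and $p=q^3$). The identity is understood for values of the parameters for which no denominator vanishes. *)

(* Defs.v *)
From HB Require Import structures.
From mathcomp Require Import all_boot all_order all_algebra.
From mathcomp Require Import reals.
From mathcomp Require Import complex.

Set Implicit Arguments.
Unset Strict Implicit.
Unset Printing Implicit Defensive.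

Import Order.TTheory GRing.Theory Num.Theory.
Local Open Scope ring_scope.

Section QPochhammer.
Variable C : fieldType.

Definition qpoch (a p : C) (m : nat) : C :=
  \prod_(0 <= j < m) (1 - a * p ^+ j).

Definition qpochs (s : seq C) (p : C) (m : nat) : C :=
  \prod_(a <- s) qpoch a p m.

(* Division is total ([y / 0 = 0]), so this is the usual quotient only when
   [qpochs bs p m != 0]. *)
Definition qbracket (us bs : seq C) (p : C) (m : nat) : C :=
  qpochs us p m / qpochs bs p m.

End QPochhammer.

(* Main.v *)
Require Import Defs.
From HB Require Import structures.
From mathcomp Require Import all_boot all_order all_algebra.
From mathcomp Require Import reals.
From mathcomp Require Import complex.
From mathcomp Require Import ring zify.

Import Order.TTheory GRing.Theory Num.Theory.
Local Open Scope ring_scope.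

(** For [l = 0] the identity evaluates a terminating cubic sum in closed form;
    multiplied by [(1 - q^(3n-1)) (1 - q^(3n+1))], its [n]-th step telescopes in
    the summation index.  For general [l], the terminating very-well-poised
    6phi5 summation with [a = x^2 q^-2], [b = x q^k], [c = - x q^(-1/2)] expands
    [(x, q^(2-l)/x; q)_k / (- q^(3/2-l); q)_k] as a combination over [i <= l] of
    [(q^i x, q^(2-i)/x; q)_k / (- q^(3/2); q)_k]; exchanging the two sums leaves
    the case [l = 0] at [q^i x].  This needs [(- q^(3/2); q)_n] and
    [(x q^(-1-k); q)_l] to be nonzero, which the hypotheses do not give; but with
    [x] fixed both sides are rational functions of [q^(1/2)], regular at the
    given point, so it is enough to have the identity at all but finitely many
    values of [q^(1/2)]. *)

(** * Sums of q-shifted factorials *)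

Section QPochhammerSums.
Context {F : fieldType}.
Implicit Types (a b c h p q x : F) (m k l n : nat).

(** * Splitting, reversal and reflection of q-shifted factorials *)

Lemma qpoch0 a p : qpoch a p 0 = 1.
Proof. by rewrite /qpoch big_geq. Qed.

Lemma qpochS a p m : qpoch a p m.+1 = qpoch a p m * (1 - a * p ^+ m).
Proof. by rewrite /qpoch big_nat_recr. Qed.

Lemma qpochD a p m k :
  qpoch a p (m + k) = qpoch a p m * qpoch (a * p ^+ m) p k.
Proof.
elim: k => [|k IHk]; first by rewrite addn0 qpoch0 mulr1.
by rewrite addnS !qpochS IHk exprD !mulrA.
Qed.

Lemma qpochSl a p m : qpoch a p m.+1 = (1 - a) * qpoch (a * p) p m.
Proof. by rewrite -add1n qpochD qpochS qpoch0 mul1r mulr1. Qed.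

Lemma qpoch_neq0P a p m :
  reflect (forall j, (j < m)%N -> 1 - a * p ^+ j != 0) (qpoch a p m != 0).
Proof.
rewrite /qpoch prodf_seq_neq0; apply: (iffP allP) => [h j jm|h j].
  by apply: (h j); rewrite mem_index_iota.
by rewrite mem_index_iota /= => /h.
Qed.

Lemma qpoch_neq0W {a p m k} : (k <= m)%N -> qpoch a p m != 0 -> qpoch a p k != 0.
Proof.
move=> km /qpoch_neq0P h; apply/qpoch_neq0P => j jk.
by apply: h; apply: leq_trans km.
Qed.

Lemma qpoch_opp a p m :
  qpoch a p m * qpoch (- a) p m = qpoch (a ^+ 2) (p ^+ 2) m.
Proof.
elim: m => [|m IHm]; first by rewrite !qpoch0 mulr1.
rewrite !qpochS -IHm -!exprM mulnC exprM; ring.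
Qed.

Lemma qpoch_shift a p m k :
  qpoch a p m * qpoch (p ^+ m * a) p k = qpoch a p k * qpoch (a * p ^+ k) p m.
Proof. by rewrite [p ^+ m * a]mulrC -!qpochD addnC. Qed.

(** Each factor is turned around as [1 - a q^j = - a q^j (1 - q^(-j) / a)]; read backwards, the last
    factors form a q-shifted factorial starting at [q / (a q^k)]. *)
Lemma qpoch_rev q a k : q != 0 -> a != 0 ->
  qpoch a q k =
  \prod_(0 <= j < k) (- (a * q ^+ j)) * qpoch (q / (a * q ^+ k)) q k.
Proof.
move=> q0 a0; elim: k => [|k IHk]; first by rewrite !qpoch0 big_geq ?mulr1.
rewrite qpochS IHk big_nat_recr //= qpochSl.
have -> : q / (a * q ^+ k.+1) * q = q / (a * q ^+ k).
  by rewrite (exprS q k); field; rewrite q0 a0 expf_neq0.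
rewrite exprS; field; by rewrite q0 a0 expf_neq0.
Qed.

(** Reversing both factorials of length [k] on the [q^2] side makes them start at [x q^i / q^(k+1)]
    and [x / q^(k+1)], with monomials that differ by [q^(k i)]. What remains is to split
    [(x / q^(k+1); q)_(k+i)] at [i] and at [k]. *)
Lemma qpoch_reflect q x k i : q != 0 -> x != 0 ->
  qpoch (q ^+ 2 / (q ^+ i * x)) q k * qpoch (x / q ^+ k.+1) q i =
  qpoch (q ^+ 2 / x) q k * qpoch (x / q) q i / q ^+ (k * i).
Proof.
move=> q0 x0; have qn m : q ^+ m != 0 by rewrite expf_neq0.
rewrite [qpoch (_ / (_ * x)) q k]qpoch_rev // ?mulf_neq0 ?invr_eq0 ?mulf_neq0 //.
rewrite [qpoch (_ / x) q k]qpoch_rev // ?mulf_neq0 ?invr_eq0 //.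
have -> : \prod_(0 <= j < k) - (q ^+ 2 / (q ^+ i * x) * q ^+ j) =
    (\prod_(0 <= j < k) - (q ^+ 2 / x * q ^+ j)) / q ^+ (k * i).
  elim: k => [|k IHk]; first by rewrite !big_geq // mul0n divr1.
  rewrite !big_nat_recr //= IHk mulSn exprD; field.
  by rewrite x0 !qn.
have -> : q / (q ^+ 2 / (q ^+ i * x) * q ^+ k) = x / q ^+ k.+1 * q ^+ i.
  by rewrite (exprS q k); field; rewrite q0 x0 !qn.
have -> : q / (q ^+ 2 / x * q ^+ k) = x / q ^+ k.+1.
  by rewrite (exprS q k); field; rewrite q0 x0 !qn.
have -> : x / q = x / q ^+ k.+1 * q ^+ k.
  by rewrite (exprS q k); field; rewrite q0 !qn.
have h := qpochD (x / q ^+ k.+1) q i k.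
rewrite addnC qpochD in h.
set P := \prod_(0 <= j < k) _; set Q := q ^+ (k * i).
rewrite [RHS](_ : _ = P / Q * (qpoch (x / q ^+ k.+1) q k *
  qpoch (x / q ^+ k.+1 * q ^+ k) q i)); last by ring.
by rewrite h; ring.
Qed.

(** * The summation formulas: 6phi5, the cubic sum and the expansion *)

Lemma sum_6phi5 q a b c l : q != 0 -> b != 0 -> c != 0 ->
  (forall j, (0 < j <= l)%N -> 1 - q ^+ j != 0) ->
  (forall j, (j <= l.*2)%N -> 1 - a * q ^+ j != 0) ->
  qpoch (a * q / b) q l != 0 -> qpoch (a * q / c) q l != 0 ->
  \sum_(0 <= i < l.+1)
     (1 - a * q ^+ i.*2) / (1 - a) *
     ((qpoch a q i * qpoch b q i * qpoch c q i * qpoch (q ^+ l)^-1 q i) /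
      (qpoch q q i * qpoch (a * q / b) q i * qpoch (a * q / c) q i *
       qpoch (a * q ^+ l.+1) q i)) * (a * q ^+ l.+1 / (b * c)) ^+ i =
  (qpoch (a * q) q l * qpoch (a * q / (b * c)) q l) /
  (qpoch (a * q / b) q l * qpoch (a * q / c) q l).
Proof.
move=> q0 b0 c0; have qn m : q ^+ m != 0 by rewrite expf_neq0.
(* The closed form satisfies a first-order recurrence in [l]; the sum satisfies the same one,
   because the corresponding combination of summands telescopes in [i]. *)
elim: l => [|l IHl] hq ha hb hc.
  rewrite big_nat1 !qpoch0 expr0; have := ha 0%N isT; rewrite expr0 mulr1 => a1.
  by field; rewrite oner_eq0.
pose A := q ^+ l.+1.
(* [(a A; q)_(i+1)] is a multiple of both [(a q^(l+1); q)_i] and [(a q^(l+2); q)_i], so the [i]-th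
   terms for [l] and for [l.+1] are both [U i] times a few simple factors. *)
pose U i := (qpoch a q i * qpoch b q i * qpoch c q i * qpoch A^-1 q i) /
      (qpoch q q i * qpoch (a * q / b) q i * qpoch (a * q / c) q i *
       qpoch (a * A) q i.+1) * (a * A / (b * c)) ^+ i.
pose D i := U i * (1 - a * q ^+ i.*2) *
   ((1 - a * A / b) * (1 - a * A / c) * q ^+ i * (1 - A^-1) -
    (1 - a * A / (b * c)) * (1 - q ^+ i / A) * (1 - a * A * q ^+ i)).
have A0 : A != 0 by exact: qn.
have A1 : 1 - A != 0 by apply: hq; rewrite leqnn.
have aA m : (m <= l.+1)%N -> 1 - a * A * q ^+ m != 0.
  by move=> ml; rewrite -mulrA -exprD; apply: ha; rewrite -addnn leq_add2l.
have a1 : 1 - a != 0 by have := ha 0%N isT; rewrite expr0 mulr1.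
(* The left side is the closed form of the partial sum of [D] up to [m]; the ratio of [U m.+1] to
   [U m] puts it in a shape to which [D m.+1] can be added. *)
have US m : (m <= l)%N ->
    (1 - a * q ^+ m) * (1 - b * q ^+ m) * (1 - c * q ^+ m) *
      (1 - q ^+ m / A) * (a * A / (b * c)) * U m =
    (1 - q ^+ m.+1) * (1 - a * q ^+ m.+1 / b) * (1 - a * q ^+ m.+1 / c) *
      (1 - a * A * q ^+ m.+1) * U m.+1.
  move=> ml; have q1 : 1 - q ^+ m.+1 != 0 by apply: hq.
  have hb' : 1 - a * q / b * q ^+ m != 0 by move/qpoch_neq0P: hb => ->.
  have hc' : 1 - a * q / c * q ^+ m != 0 by move/qpoch_neq0P: hc => ->.
  have haA : 1 - a * A * q ^+ m.+1 != 0 by exact: aA.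
  rewrite /U (qpochS (a * A) q m.+1).
  move: (qpoch (a * A) q m.+1) => e.
  rewrite !(qpochS _ _ m) [(_ / (b * c)) ^+ m.+1]exprS.
  rewrite -[q * q ^+ m]exprS [A^-1 * _]mulrC.
  have -> : a * q ^+ m.+1 / b = a * q / b * q ^+ m by rewrite exprS; ring.
  have -> : a * q ^+ m.+1 / c = a * q / c * q ^+ m by rewrite exprS; ring.
  move: (1 - q ^+ m.+1) (1 - a * q / b * q ^+ m) (1 - a * q / c * q ^+ m)
    (1 - a * A * q ^+ m.+1) q1 hb' hc' haA => d1 d2 d3 d4 h1 h2 h3 h4.
  rewrite !invfM; move: (qpoch q q m)^-1 (qpoch (a * q / b) q m)^-1
   (qpoch (a * q / c) q m)^-1 e^-1 => e1 e2 e3 e4.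
  by field; rewrite b0 c0 h1 h2 h3 h4.
(* Up to a common factor, [D i] is the difference of the [i]-th terms of the
   identities for [l.+1] and [l], each multiplied by the denominator of the ratio
   of the right-hand sides. *)
have tele m : (m <= l.+1)%N -> \sum_(0 <= i < m.+1) D i =
    (1 - a * q ^+ m) * (1 - b * q ^+ m) * (1 - c * q ^+ m) *
    (1 - q ^+ m / A) * (a * A / (b * c)) * U m.
  elim: m => [_|m IHm ml].
    rewrite big_nat1 /D /U !qpochS !qpoch0 !expr0.
    by field; rewrite b0 c0 A0 -[a * A]mulr1 -(expr0 q) aA.
  rewrite big_nat_recr //= IHm ?(ltnW ml) // US // /D.
  have -> : q ^+ m.+1.*2 = q ^+ m.+1 * q ^+ m.+1 by rewrite -exprD addnn.
  by move: (q ^+ m.+1) (U m.+1) => Q V; field; rewrite b0 c0 A0.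
have A1' : 1 - A^-1 != 0.
  by apply: contra A1; rewrite !subr_eq0 => /eqP h; rewrite -[A]invrK -h invr1.
have aA1 : 1 - a * A != 0 by have := aA 0%N isT; rewrite expr0 mulr1.
have bA : 1 - a * A / b != 0.
  by move/qpoch_neq0P: hb => /(_ l (ltnSn l));
  rewrite mulrAC -[a * q * _]mulrA -exprS.
have cA : 1 - a * A / c != 0.
  by move/qpoch_neq0P: hc => /(_ l (ltnSn l));
  rewrite mulrAC -[a * q * _]mulrA -exprS.
pose T m i := (1 - a * q ^+ i.*2) / (1 - a) *
     ((qpoch a q i * qpoch b q i * qpoch c q i * qpoch (q ^+ m)^-1 q i) /
      (qpoch q q i * qpoch (a * q / b) q i * qpoch (a * q / c) q i *
       qpoch (a * q ^+ m.+1) q i)) * (a * q ^+ m.+1 / (b * c)) ^+ i.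
have TD i : (i <= l.+1)%N ->
    (1 - a * A / b) * (1 - a * A / c) * T l.+1 i -
    (1 - a * A) * (1 - a * A / (b * c)) * T l i =
    D i * ((1 - a * A) / ((1 - a) * (1 - A^-1))).
  move=> il; rewrite /T /D /U (qpochSl (a * A)).
  have -> : a * A * q = a * q ^+ l.+2 by rewrite -mulrA -exprSr.
  have -> : (q ^+ l)^-1 = A^-1 * q by rewrite /A exprSr; field; rewrite q0 qn.
  have -> : qpoch (A^-1 * q) q i =
      qpoch A^-1 q i * (1 - A^-1 * q ^+ i) / (1 - A^-1).
    by apply: (mulIf A1'); rewrite divfK // -qpochS qpochSl mulrC.
  have -> : qpoch (a * q ^+ l.+2) q i =
      qpoch (a * q ^+ l.+1) q i * (1 - a * A * q ^+ i) / (1 - a * A).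
    apply: (mulIf aA1); rewrite divfK // -qpochS qpochSl mulrC.
    by rewrite -[a * A * q]mulrA -exprSr.
  have -> : a * q ^+ l.+2 / (b * c) = a * A / (b * c) * q.
    by rewrite (exprSr q l.+1) -/A; ring.
  rewrite exprMn -/A.
  have hA := aA i il.
  rewrite !invfM invrK; move: (qpoch q q i)^-1 (qpoch (a * q / b) q i)^-1
   (qpoch (a * q / c) q i)^-1 (qpoch (a * A) q i)^-1 => e1 e2 e3 e4.
  move: (q ^+ i) hA (q ^+ i.*2) => Q hA Q2.
  by field; rewrite b0 c0 a1 A0 aA1 hA -opprB oppr_eq0 A1.
(* As [A = q^(l+1)], the factor [1 - q^m / A] of the closed form vanishes at [m = l.+1]. *)
have sumD : \sum_(0 <= i < l.+2) D i = 0.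
  by rewrite tele // divff // subrr !(mulr0, mul0r).
(* [(q^(-l); q)_(l+1)] contains the factor [1 - 1], so the sum for [l] may run up to [l.+1] as
   well. *)
have Tl : T l l.+1 = 0.
  rewrite /T (qpochS (q ^+ l)^-1) mulVf // subrr.
  by rewrite !(mulr0, mul0r).
have sT : (1 - a * A / b) * (1 - a * A / c) * \sum_(0 <= i < l.+2) T l.+1 i =
    (1 - a * A) * (1 - a * A / (b * c)) * \sum_(0 <= i < l.+1) T l i.
  have -> : \sum_(0 <= i < l.+1) T l i = \sum_(0 <= i < l.+2) T l i.
    by rewrite [RHS]big_nat_recr //= Tl addr0.
  apply/eqP; rewrite -subr_eq0 !mulr_sumr -sumrB.
  rewrite (eq_big_nat _ _ 
    (F2 := fun i => D i * ((1 - a * A) / ((1 - a) * (1 - A^-1))))).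
    by rewrite -mulr_suml sumD mul0r.
  by move=> j /andP[_ jl]; exact: TD.
have hq' j : (0 < j <= l)%N -> 1 - q ^+ j != 0.
  by move=> /andP[j0 jl]; apply: hq; rewrite j0 ltnW.
have ha' j : (j <= l.*2)%N -> 1 - a * q ^+ j != 0.
  by move=> jl; apply: ha; apply: leq_trans jl _; rewrite leq_double.
have hbl := qpoch_neq0W (leqnSn l) hb; have hcl := qpoch_neq0W (leqnSn l) hc.
rewrite (IHl hq' ha' hbl hcl : \sum_(0 <= i < l.+1) T l i = _) in sT.
apply: (mulfI (mulf_neq0 bA cA)); rewrite [LHS]sT.
rewrite !(qpochS _ _ l).
have -> : a * q * q ^+ l = a * A by rewrite -mulrA -exprS.
have -> : a * q / (b * c) * q ^+ l = a * A / (b * c).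
  by rewrite mulrAC -[a * q * _]mulrA -exprS.
have -> : a * q / b * q ^+ l = a * A / b by rewrite mulrAC -[a * q * _]mulrA -exprS.
have -> : a * q / c * q ^+ l = a * A / c by rewrite mulrAC -[a * q * _]mulrA -exprS.
move: (1 - a * A / b) (1 - a * A / c) bA cA => d e dA eA.
by field; rewrite hbl hcl dA eA b0 c0.
Qed.

(** This is the case [l = 0]: there [(q, -q; q)_k] is [(q^2; q^2)_k] and [(q^(3/2), -q^(3/2); q)_k]
    is [(q^3; q^2)_k], so no square root of [q] is left. *)
Lemma sum_cubic q x n : q != 0 -> x != 0 ->
  (forall j, (1 < j <= (3 * n).+1)%N -> 1 - q ^+ j != 0) ->
  \sum_(0 <= k < n.+1)
    qpoch (q ^+ (3 * n))^-1 (q ^+ 3) k * (qpoch x q k * qpoch (q ^+ 2 / x) q k) /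
    (qpoch (q ^+ 2) (q ^+ 2) k * qpoch (q ^+ 3) (q ^+ 2) k *
     qpoch (q ^+ (3 * n).+1)^-1 q k) * q ^+ k =
  (qpoch (q ^+ 2 * x) (q ^+ 3) n * qpoch (q ^+ 4 / x) (q ^+ 3) n) /
  (qpoch (q ^+ 2) (q ^+ 3) n * qpoch (q ^+ 4) (q ^+ 3) n).
Proof.
move=> q0 x0; have qn m : q ^+ m != 0 by rewrite expf_neq0.
elim: n => [|n IHn] hq.
  by rewrite big_nat1 !qpoch0 expr0; field; rewrite oner_eq0.
pose N := q ^+ (3 * n.+1).
have N0 : N != 0 by exact: qn.
have E1 : q ^+ (3 * n) = N / q ^+ 3.
  by rewrite /N mulnS exprD mulrAC divff ?mul1r ?qn.
have E2 : q ^+ (3 * n).+1 = N / q ^+ 2.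
  by rewrite exprS E1; field.
have E3 : q ^+ (3 * n.+1).+1 = N * q by rewrite exprSr.
have q1 : 1 - q != 0.
  have : 1 - q ^+ 2 != 0 by apply: hq; lia.
  by apply: contra => /eqP h; rewrite -opprB subr_sqr_1 -opprB h oppr0 mul0r oppr0.
have hq0 j : (0 < j <= (3 * n.+1).+1)%N -> 1 - q ^+ j != 0.
  by case: j => [//|[|j] hj]; [rewrite expr1|apply: hq].
have hN j : (j < 3 * n.+1)%N -> 1 - q ^+ j / N != 0.
  move=> jn; have := hq0 (3 * n.+1 - j)%N.
  rewrite subn_gt0 jn (leq_trans (leq_subr _ _)) // => /(_ isT).
  apply: contra; rewrite !subr_eq0 => /eqP h; apply/eqP.
  have jN : q ^+ (3 * n.+1 - j) * q ^+ j = N by rewrite -exprD subnK // ltnW.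
  by rewrite -[RHS]mulr1 h mulrA jN divff.
have hN1 : 1 - (N * q)^-1 != 0.
  rewrite -E3; have := hq0 _ (leqnn _ : (0 < (3 * n.+1).+1 <= (3 * n.+1).+1)%N).
  by rewrite !subr_eq0 [1 == _^-1]eq_sym invr_eq1 eq_sym.
have hN2 : 1 - N^-1 != 0 by have := hN 0%N isT; rewrite expr0 mul1r.
have hN3 : 1 - q / N != 0 by have := hN 1%N; rewrite expr1; apply; lia.
have dA k : (k <= n)%N -> 1 - q ^+ 2 / N * q ^+ k != 0.
  by move=> kn; rewrite mulrAC -exprD; apply: hN; lia.
(* [V k] mixes two levels: [N^-1] belongs to the term for [n.+1], [q^2 / N] to the term for [n].
   Each of these terms is, up to a constant, [V k] times a polynomial in [q^k]. *)
pose V k := qpoch N^-1 (q ^+ 3) k * (qpoch x q k * qpoch (q ^+ 2 / x) q k) /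
    (qpoch (q ^+ 2) (q ^+ 2) k * qpoch (q ^+ 3) (q ^+ 2) k *
     qpoch (q ^+ 2 / N) q k) * q ^+ k.
have VS k : (k <= n)%N ->
    V k * ((1 - x * q ^+ k) * (1 - q ^+ 2 / x * q ^+ k) *
           (1 - (q ^+ k) ^+ 3 / N) * q) =
    V k.+1 * ((1 - (q ^+ k.+1) ^+ 2) * (1 - q * (q ^+ k.+1) ^+ 2) *
              (1 - q / N * q ^+ k.+1)).
  move=> kn; rewrite /V !(qpochS _ _ k) [q ^+ k.+1]exprS.
  have -> : (q ^+ 3) ^+ k = (q ^+ k) ^+ 3 by rewrite exprAC.
  have -> : (q ^+ 2) ^+ k = (q ^+ k) ^+ 2 by rewrite exprAC.
  have h1 := dA k kn.
  have h2 : 1 - q ^+ 2 * (q ^+ k) ^+ 2 != 0.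
    by rewrite -exprMn -exprS -exprM; apply: hq; lia.
  have h3 : 1 - q ^+ 3 * (q ^+ k) ^+ 2 != 0.
    by rewrite -exprM -exprD; apply: hq; clear -kn; lia.
  have -> : (q * q ^+ k) ^+ 2 = q ^+ 2 * (q ^+ k) ^+ 2 by rewrite exprMn.
  have -> : q * (q ^+ 2 * (q ^+ k) ^+ 2) = q ^+ 3 * (q ^+ k) ^+ 2 by ring.
  have -> : q / N * (q * q ^+ k) = q ^+ 2 / N * q ^+ k by ring.
  move: (1 - q ^+ 2 / N * q ^+ k) (1 - q ^+ 2 * (q ^+ k) ^+ 2)
    (1 - q ^+ 3 * (q ^+ k) ^+ 2) h1 h2 h3 => d1 d2 d3 h1 h2 h3.
  rewrite !invfM.
  move: (qpoch (q ^+ 2) (q ^+ 2) k)^-1 (qpoch (q ^+ 3) (q ^+ 2) k)^-1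
   (qpoch (q ^+ 2 / N) q k)^-1 => e1 e2 e3.
  by field; rewrite x0 N0 h1 h2 h3.
(* [N^2] is the quotient of [(1 - N / q) (1 - N q)] by [(1 - q / N) (1 - 1 / (N q))]. The last
   factor of the closed form vanishes at [m = n.+1], where [(q^m)^3 = N]. *)
have tele m : (m <= n.+1)%N ->
    \sum_(0 <= k < m.+1) V k * (N ^+ 2 * (1 - q ^+ k / N) *
      (1 - q ^+ k / (N * q)) * (1 - q ^+ k * q / N) -
      (1 - N * x / q) * (1 - N * q / x) * (1 - (q ^+ k) ^+ 3 / N)) =
    - (N / (q * q ^+ m)) * V m * ((1 - x * q ^+ m) *
      (1 - q ^+ 2 / x * q ^+ m) * (1 - (q ^+ m) ^+ 3 / N)).
  elim: m => [_|m IHm ml].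
    by rewrite big_nat1 expr0; field; rewrite q0 x0 N0.
  rewrite big_nat_recr //= IHm ?(ltnW ml) //.
  have -> : - (N / (q * q ^+ m)) * V m * ((1 - x * q ^+ m) *
      (1 - q ^+ 2 / x * q ^+ m) * (1 - (q ^+ m) ^+ 3 / N)) =
      - (N / (q * q ^+ m.+1)) * (V m * ((1 - x * q ^+ m) *
      (1 - q ^+ 2 / x * q ^+ m) * (1 - (q ^+ m) ^+ 3 / N) * q)).
    by rewrite (exprS q m); field; rewrite q0 x0 N0 qn.
  rewrite VS //; move: (q ^+ m.+1) (qn m.+1) (V m.+1) => K K0 W.
  by field; rewrite q0 x0 N0 K0.
have tA k : (k <= n.+1)%N ->
    qpoch (q ^+ (3 * n))^-1 (q ^+ 3) k * (qpoch x q k * qpoch (q ^+ 2 / x) q k) /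
    (qpoch (q ^+ 2) (q ^+ 2) k * qpoch (q ^+ 3) (q ^+ 2) k *
     qpoch (q ^+ (3 * n).+1)^-1 q k) * q ^+ k =
    V k * (1 - (q ^+ k) ^+ 3 / N) / (1 - N^-1).
  move=> kn; rewrite E1 E2 /V !invf_div.
  have -> : qpoch (q ^+ 3 / N) (q ^+ 3) k =
      qpoch N^-1 (q ^+ 3) k * (1 - (q ^+ k) ^+ 3 / N) / (1 - N^-1).
    apply: (mulIf hN2); rewrite divfK // exprAC [(q ^+ 3) ^+ k / N]mulrC -qpochS.
    by rewrite qpochSl mulrC [N^-1 * _]mulrC.
  ring.
have tB k : (k <= n.+1)%N ->
    qpoch (q ^+ (3 * n.+1))^-1 (q ^+ 3) k *
      (qpoch x q k * qpoch (q ^+ 2 / x) q k) /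
    (qpoch (q ^+ 2) (q ^+ 2) k * qpoch (q ^+ 3) (q ^+ 2) k *
     qpoch (q ^+ (3 * n.+1).+1)^-1 q k) * q ^+ k =
    V k * ((1 - q ^+ k / N) * (1 - q ^+ k / (N * q)) * (1 - q ^+ k * q / N)) /
    ((1 - N^-1) * (1 - (N * q)^-1) * (1 - q / N)).
  move=> kn; rewrite E3 -/N /V.
  have dk : (1 - q ^+ k / N) * (1 - q ^+ k / (N * q)) * (1 - q ^+ k * q / N) != 0.
    rewrite !mulf_neq0 //; first by apply: hN; lia.
      case: k kn => [_|k kn]; first by rewrite expr0 mul1r.
      have -> : q ^+ k.+1 / (N * q) = q ^+ k / N.
        by rewrite exprSr; field; rewrite q0 N0.
      by apply: hN; lia.
    by rewrite -exprSr; apply: hN; lia.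
  (* Both sides are [(1 / (N q); q)_(k+3)], split after 3 and after [k] factors. *)
  have : qpoch (q ^+ 2 / N) q k * ((1 - N^-1) * (1 - (N * q)^-1) * (1 - q / N)) =
    qpoch (N * q)^-1 q k * 
    ((1 - q ^+ k / N) * (1 - q ^+ k / (N * q)) * (1 - q ^+ k * q / N)).
    have := qpochD (N * q)^-1 q 3 k.
    have -> : (N * q)^-1 * q ^+ 3 = q ^+ 2 / N by field; rewrite q0 N0.
    rewrite addnC qpochD !qpochS !qpoch0 !mul1r !expr0 => h.
    transitivity (qpoch (N * q)^-1 q k *
       ((1 - (N * q)^-1 * q ^+ k * 1) * (1 - (N * q)^-1 * q ^+ k * q ^+ 1) *
        (1 - (N * q)^-1 * q ^+ k * q ^+ 2))).
      rewrite h; field.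
      by rewrite N0 q0.
    by field; rewrite N0 q0.
  move: (_ * (1 - q ^+ k * q / N)) dk => D D0 /esym /(canRL (mulfK D0)) ->.
  by rewrite !invfM invrK; ring.
pose tn m k := qpoch (q ^+ (3 * m))^-1 (q ^+ 3) k *
    (qpoch x q k * qpoch (q ^+ 2 / x) q k) /
    (qpoch (q ^+ 2) (q ^+ 2) k * qpoch (q ^+ 3) (q ^+ 2) k *
     qpoch (q ^+ (3 * m).+1)^-1 q k) * q ^+ k.
have last0 : (q ^+ n.+1) ^+ 3 = N by rewrite -exprM mulnC.
have sumA : \sum_(0 <= k < n.+1) tn n k = \sum_(0 <= k < n.+2) tn n k.
  rewrite [RHS]big_nat_recr //= [tn n n.+1]tA // last0 divff // subrr.
  by rewrite mulr0 mul0r addr0.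
(* The multipliers are the last factors of the four factorials of length [n.+1] in the closed form,
   those of its denominator on the left and those of its numerator on the right. *)
have step : (1 - N / q) * (1 - N * q) * \sum_(0 <= k < n.+2) tn n.+1 k =
    (1 - N * x / q) * (1 - N * q / x) * \sum_(0 <= k < n.+1) tn n k.
  apply/eqP; rewrite sumA -subr_eq0 !mulr_sumr -sumrB.
  rewrite (eq_big_nat _ _ (F2 := fun k => V k * (N ^+ 2 * (1 - q ^+ k / N) *
      (1 - q ^+ k / (N * q)) * (1 - q ^+ k * q / N) -
      (1 - N * x / q) * (1 - N * q / x) * (1 - (q ^+ k) ^+ 3 / N)) / (1 - N^-1))).
    by rewrite -mulr_suml tele // last0 divff // subrr !mulr0 mul0r.
  move=> k /andP[_ kn]; rewrite [tn n k]tA // [tn n.+1 k]tB //.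
  move: (V k) (q ^+ k) => W K; field.
  have -> : N - q = N * (1 - q / N) by field.
  have -> : N - 1 = N * (1 - N^-1) by field.
  have -> : N * q - 1 = N * q * (1 - (N * q)^-1) by field; rewrite q0 N0.
  by rewrite !mulf_eq0 !negb_or N0 q0 x0 hN1 hN2 hN3.
have hq' j : (1 < j <= (3 * n).+1)%N -> 1 - q ^+ j != 0.
  by move=> hj; apply: hq; lia.
rewrite (IHn hq' : \sum_(0 <= k < n.+1) tn n k = _) in step.
rewrite -[LHS]/(\sum_(0 <= k < n.+2) tn n.+1 k) !(qpochS _ _ n) -!exprM E1.
have -> : q ^+ 2 * x * (N / q ^+ 3) = N * x / q by field.
have -> : q ^+ 4 / x * (N / q ^+ 3) = N * q / x by field; rewrite q0 x0.
have -> : q ^+ 2 * (N / q ^+ 3) = N / q by field.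
have -> : q ^+ 4 * (N / q ^+ 3) = N * q by field.
have hNq : 1 - N * q != 0 by rewrite -E3; apply: hq; lia.
have hNq' : 1 - N / q != 0.
  have -> : N / q = q ^+ (3 * n).+2 by rewrite exprSr E2; field.
  by apply: hq; clear; lia.
apply: (mulfI (mulf_neq0 hNq' hNq)); rewrite step.
have h1 : qpoch (q ^+ 2) (q ^+ 3) n != 0.
  by apply/qpoch_neq0P => j jn; rewrite -exprM -exprD; apply: hq; clear -jn; lia.
have h2 : qpoch (q ^+ 4) (q ^+ 3) n != 0.
  by apply/qpoch_neq0P => j jn; rewrite -exprM -exprD; apply: hq; clear -jn; lia.
move: (1 - N / q) (1 - N * q) hNq hNq' => d e d0 e0.
by field; rewrite d0 e0 h1 h2 x0 q0.
Qed.

(** With [a = x^2 / q^2], the choice [c = - x / h] gives [a q / c = c], so the factorials in [c]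
    cancel from the 6phi5 summand, and [k] enters only through [b = x q^k]. *)
Lemma qpoch_expansion h q x l k : h ^+ 2 = q -> h != 0 -> x != 0 ->
  (forall j, (0 < j <= l)%N -> 1 - q ^+ j != 0) ->
  (forall j, (j <= l.*2)%N -> 1 - x ^+ 2 / q ^+ 2 * q ^+ j != 0) ->
  qpoch (x / q) q l != 0 -> qpoch (x / q ^+ k.+1) q l != 0 ->
  qpoch (- h^-1) q l != 0 -> qpoch (- (h ^+ 3 / q ^+ l)) q k != 0 ->
  (qpoch (x / q) q l * qpoch (- (x / h)) q l) /
  (qpoch (x ^+ 2 / q) q l * qpoch (- h^-1) q l) *
  \sum_(0 <= i < l.+1)
    (- (q ^+ l / h)) ^+ i *
    ((1 - x ^+ 2 / q ^+ 2 * q ^+ i.*2) / (1 - x ^+ 2 / q ^+ 2)) *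
    ((qpoch (q ^+ l)^-1 q i * qpoch x q i * qpoch (x ^+ 2 / q ^+ 2) q i) /
     (qpoch q q i * qpoch (x / q) q i * qpoch (x ^+ 2 / q ^+ 2 * q ^+ l.+1) q i)) *
    (qpoch (q ^+ i * x) q k * qpoch (q ^+ 2 / (q ^+ i * x)) q k) =
  qpoch x q k * qpoch (q ^+ 2 / (q ^+ l * x)) q k *
  qpoch (- h ^+ 3) q k / qpoch (- (h ^+ 3 / q ^+ l)) q k.
Proof.
move=> qE h0 x0 hq ha hx hxk hh hhk.
have q0 : q != 0 by rewrite -qE expf_neq0.
have qn m : q ^+ m != 0 by rewrite expf_neq0.
have b0 : x * q ^+ k != 0 by rewrite mulf_neq0.
have c0 : - (x / h) != 0 by rewrite oppr_eq0 mulf_neq0 ?invr_eq0.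
have Eb : x ^+ 2 / q ^+ 2 * q / (x * q ^+ k) = x / q ^+ k.+1.
  by rewrite (exprS q k); field; rewrite ?oppr_eq0 ?x0 ?q0 ?qn.
have Ec : x ^+ 2 / q ^+ 2 * q / (- (x / h)) = - (x / h).
  by rewrite -qE; field; rewrite ?oppr_eq0 x0 h0.
have Ebc : x ^+ 2 / q ^+ 2 * q / (x * q ^+ k * - (x / h)) = - h / q ^+ k.+1.
  rewrite (exprS q k); move: (q ^+ k) (qn k) => K Kn; rewrite -qE.
  by field; rewrite ?oppr_eq0 ?x0 ?h0 ?Kn.
have Ez : x ^+ 2 / q ^+ 2 * q ^+ l.+1 / (x * q ^+ k * - (x / h)) =
    - (q ^+ l / h) / q ^+ k.
  rewrite (exprS q l); move: (q ^+ k) (qn k) (q ^+ l) => K Kn L.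
  by rewrite -qE; field; rewrite ?oppr_eq0 ?x0 ?h0 ?Kn.
(* [(c q^j)^2 = a q^(2j+1)], and [2j+1] is within the range of [ha]. *)
have hc : qpoch (- (x / h)) q l != 0.
  apply/qpoch_neq0P => j jl; have := ha j.*2.+1; rewrite ltn_double => /(_ jl).
  apply: contra => /eqP h1.
  have -> : x ^+ 2 / q ^+ 2 * q ^+ j.*2.+1 = (- (x / h) * q ^+ j) ^+ 2.
    rewrite (exprS q j.*2) -addnn exprD; move: (q ^+ j) => J; rewrite -qE.
    by field.
  by rewrite -[1 - _]opprB subr_sqr_1 -opprB h1 oppr0 mul0r oppr0.
have := sum_6phi5 q _ _ _ l q0 b0 c0 hq ha.
rewrite Eb Ec => /(_ hxk hc).
rewrite Ebc Ez => S65.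
(* Shifting and reflecting trade the factorials of length [k] that depend on [i] for factorials of
   length [i]; the power [q^(-k i)] goes into the argument of the 6phi5. *)
have T i : (0 <= i < l.+1)%N ->
  (- (q ^+ l / h)) ^+ i *
    ((1 - x ^+ 2 / q ^+ 2 * q ^+ i.*2) / (1 - x ^+ 2 / q ^+ 2)) *
    ((qpoch (q ^+ l)^-1 q i * qpoch x q i * qpoch (x ^+ 2 / q ^+ 2) q i) /
     (qpoch q q i * qpoch (x / q) q i * qpoch (x ^+ 2 / q ^+ 2 * q ^+ l.+1) q i)) *
    (qpoch (q ^+ i * x) q k * qpoch (q ^+ 2 / (q ^+ i * x)) q k) =
  qpoch x q k * qpoch (q ^+ 2 / x) q k *
  ((1 - x ^+ 2 / q ^+ 2 * q ^+ i.*2) / (1 - x ^+ 2 / q ^+ 2) *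
   (qpoch (x ^+ 2 / q ^+ 2) q i * qpoch (x * q ^+ k) q i *
    qpoch (- (x / h)) q i * qpoch (q ^- l) q i /
        (qpoch q q i * qpoch (x / q ^+ k.+1) q i *
         qpoch (- (x / h)) q i *
         qpoch (x ^+ 2 / q ^+ 2 * q ^+ l.+1) q i)) *
       (- (q ^+ l / h) / q ^+ k) ^+ i).
  move=> /andP[_]; rewrite ltnS => il; have h1 := qpoch_neq0W il hc.
  have h2 := qpoch_neq0W il hx.
  have h3 := qpoch_neq0W il hxk.
  have E1 := qpoch_shift x q i k.
  have /(canRL (mulfK h3)) -> := qpoch_reflect q x k i q0 x0.
  rewrite exprMn exprVn -exprM; move: (q ^+ (k * i)) (qn (k * i)%N) => e e0.
  rewrite [LHS](_ : _ = (- (q ^+ l / h)) ^+ i *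
    ((1 - x ^+ 2 / q ^+ 2 * q ^+ i.*2) / (1 - x ^+ 2 / q ^+ 2)) *
    (qpoch (q ^+ l)^-1 q i * qpoch (x ^+ 2 / q ^+ 2) q i) /
    (qpoch q q i * qpoch (x ^+ 2 / q ^+ 2 * q ^+ l.+1) q i) *
    (qpoch (q ^+ 2 / x) q k / e / qpoch (x / q ^+ k.+1) q i) *
    (qpoch x q i * qpoch (q ^+ i * x) q k)).
    rewrite E1; move: (qpoch (- (x / h)) q i) h1 (x ^+ 2 / q ^+ 2) => d d0 a.
    rewrite !invfM; move: (1 - a)^-1 (qpoch q q i)^-1 (qpoch (a * _) q i)^-1.
    move: (- (q ^+ l / h)) (qpoch (x / _) q i) h3 => Z d3 h3 e1 e2 e3.
    by field; rewrite d0 h3 e0.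
  move: (x ^+ 2 / q ^+ 2) => a.
  rewrite !invfM; move: (1 - a)^-1 (qpoch q q i)^-1 (qpoch (a * _) q i)^-1.
  move: (- (q ^+ l / h)) (qpoch (x / q ^+ k.+1) q i) h3 (qpoch (x / q) q i) h2.
  by move=> Z d3 h3 d2 h2 e1 e2 e3; field; rewrite h2 h3 e0.
rewrite (eq_big_nat _ _ T) -mulr_sumr S65.
have -> : x ^+ 2 / q ^+ 2 * q = x ^+ 2 / q by field.
have hA : qpoch (x ^+ 2 / q) q l != 0.
  apply/qpoch_neq0P => j jl.
  have -> : x ^+ 2 / q * q ^+ j = x ^+ 2 / q ^+ 2 * q ^+ j.+1.
    by rewrite (exprS q j); field.
  by apply: ha; rewrite -addnn; apply: leq_trans jl _; rewrite leq_addr.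
have /(canRL (mulfK hxk)) -> := qpoch_reflect q x k l q0 x0.
(* [(- h / q^(k+1); q)_l] is the factor [(a q / (b c); q)_l] of the summation. Since [h^2 = q],
   reflection at [- h] expresses it by [(- h^3; q)_k] over [(- h^3 / q^l; q)_k], up to
   [(- 1 / h; q)_l] and a power of [q]. *)
have := qpoch_reflect q (- h) k l q0; rewrite oppr_eq0 => /(_ h0).
have -> : q ^+ 2 / (q ^+ l * - h) = - (h ^+ 3 / q ^+ l).
  by move: (q ^+ l) (qn l) => L L0; rewrite -qE; field; rewrite oppr_eq0 h0 L0.
have -> : q ^+ 2 / - h = - h ^+ 3 by rewrite -qE; field; rewrite oppr_eq0 h0.
have -> : - h / q = - h^-1 by rewrite -qE; field.
move=> /(canRL (mulKf hhk)) ->.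
have := qn (k * l)%N; move: (q ^+ (k * l)) => e e0.
by field; rewrite hhk hxk e0 hc hh hA.
Qed.

(** * The identity under two extra nonvanishing conditions *)

Lemma qpochs_nil p m : qpochs [::] p m = 1.
Proof. by rewrite /qpochs big_nil. Qed.

Lemma qpochs_cons a s p m : qpochs (a :: s) p m = qpoch a p m * qpochs s p m.
Proof. by rewrite /qpochs big_cons. Qed.

(** Sorts these exponents into those of the factors of [(q^2; q^2)_n] and of [(q^3; q^2)_n]. *)
Lemma even_or_odd_between n j : (1 < j <= (2 * n).+1)%N ->
  exists2 m, (m < n)%N & j = (2 * m.+1)%N \/ j = (3 + 2 * m)%N.
Proof.
move=> hj; exists j./2.-1; first by lia.
by have := odd_double_half j; case: (odd j); lia.
Qed.

Definition theorem5_lhs q qh l n x : F :=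
  \sum_(0 <= k < n.+1)
     qpoch (q ^ (- (3 * n%:Z))) (q ^+ 3) k *
     qbracket [:: x; q ^ (2 - l%:Z) / x]
              [:: q; - q; qh ^+ 3; - qh ^ (3 - 2 * l%:Z);
                  q ^ (- 1 - 3 * n%:Z)] q k *
     q ^+ k.

Definition theorem5_rhs q qh l n x : F :=
  qbracket [:: x * q ^ (- 1); - (x * qh ^ (- 1))]
             [:: x ^+ 2 * q ^ (- 1); - qh ^ (- 1)] q l *
    \sum_(0 <= i < l.+1)
       (- 1) ^+ i * qh ^ ((2 * l%:Z - 1) * i%:Z) *
       ((1 - x ^+ 2 * q ^ (2 * i%:Z - 2)) / (1 - x ^+ 2 * q ^ (- 2))) *
       qbracket [:: q ^ (- l%:Z); x; x ^+ 2 * q ^ (- 2)]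
                [:: q; x * q ^ (- 1); x ^+ 2 * q ^ (l%:Z - 1)] q i *
       qbracket [:: q ^+ (2 + i) * x; q ^ (4 - i%:Z) / x]
                [:: q ^+ 2; q ^+ 4] (q ^+ 3) n.

(** [denA] allows multiplying and dividing by [(- q^(3/2); q)_k]; [denB] is the denominator
    [(a q / b; q)_l] of the 6phi5 sum for each [k]. *)
Lemma theorem5_nondegenerate q qh l n x
  (qhE : qh ^+ 2 = q)
  (q_neq0 : q != 0)
  (x_neq0 : x != 0)
  (denL : forall k : nat, (k <= n)%N ->
     qpochs [:: q; - q; qh ^+ 3; - qh ^ (3 - 2 * l%:Z);
                q ^ (- 1 - 3 * n%:Z)] q k != 0)
  (denP : qpochs [:: x ^+ 2 * q ^ (- 1); - qh ^ (- 1)] q l != 0)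
  (denW : 1 - x ^+ 2 * q ^ (- 2) != 0)
  (denI : forall i : nat, (i <= l)%N ->
     qpochs [:: q; x * q ^ (- 1); x ^+ 2 * q ^ (l%:Z - 1)] q i != 0)
  (denA : qpoch (- qh ^+ 3) q n != 0)
  (denB : forall k, (k <= n)%N -> qpoch (x / q ^+ k.+1) q l != 0) :
  theorem5_lhs q qh l n x = theorem5_rhs q qh l n x.
Proof.
rewrite /theorem5_lhs /theorem5_rhs.
have h0 : qh != 0 by move: q_neq0; rewrite -qhE expf_eq0.
have qn m : q ^+ m != 0 by rewrite expf_neq0.
have qV : q ^ (-1) = q^-1 by [].
have hV : qh ^ (-1) = qh^-1 by [].
have q2V : q ^ (-2) = (q ^+ 2)^-1 by [].
have qlV : q ^ (- l%:Z) = (q ^+ l)^-1 by rewrite exprnN.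
have E1 : q ^ (- 1 - 3 * n%:Z) = (q ^+ (3 * n).+1)^-1.
  by rewrite exprnN; congr (_ ^ _); lia.
have E2 : q ^ (- (3 * n%:Z)) = (q ^+ (3 * n))^-1.
  by rewrite exprnN; congr (_ ^ _); lia.
have E3 : qh ^ (3 - 2 * l%:Z) = qh ^+ 3 / q ^+ l.
  by rewrite expfzDr // -qhE -exprM exprnN; congr (_ * _ ^ _); lia.
have E4 : x ^+ 2 * q ^ (l%:Z - 1) = x ^+ 2 / q ^+ 2 * q ^+ l.+1.
  by rewrite expfzDr // (exprSr q l) qV -exprnP; field.
have E5 i : x ^+ 2 * q ^ (2 * i%:Z - 2) = x ^+ 2 / q ^+ 2 * q ^+ i.*2.
  have -> : 2 * i%:Z - 2 = i.*2%:Z - 2 by lia.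
  by rewrite expfzDr // q2V -exprnP mulrCA mulrC.
have E6 i : qh ^ ((2 * l%:Z - 1) * i%:Z) = (q ^+ l / qh) ^+ i.
  rewrite -exprz_exp -exprnP; congr (_ ^+ i).
  have -> : 2 * l%:Z = (2 * l)%N by lia.
  by rewrite expfzDr // hV -exprnP exprM qhE.
have E7 m i : q ^ (m%:Z - i%:Z) / x = q ^+ m / (q ^+ i * x).
  by rewrite expfzDr // -exprnN -exprnP; field; rewrite x_neq0 qn.
have E8 i : q ^+ (2 + i) * x = q ^+ 2 * (q ^+ i * x) by rewrite exprD mulrA.
under eq_bigr do rewrite (E7 2%N).
under [in RHS]eq_bigr do rewrite (E7 4%N) E5 E6 E8 E4.
rewrite ?E1 ?E2 ?E3 ?E4 ?qV ?hV ?q2V ?qlV.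
rewrite E3 E1 in denL; rewrite qV hV in denP; rewrite q2V in denW.
rewrite qV E4 in denI.
under eq_bigr do rewrite /qbracket !qpochs_cons !qpochs_nil !mulr1.
under [in RHS]eq_bigr do
  rewrite /qbracket !qpochs_cons !qpochs_nil !mulr1 -exprMn mulN1r.
rewrite /qbracket !qpochs_cons !qpochs_nil !mulr1.
have hL k : (k <= n)%N -> [/\ qpoch q q k != 0, qpoch (- q) q k != 0,
    qpoch (qh ^+ 3) q k != 0, qpoch (- (qh ^+ 3 / q ^+ l)) q k != 0 &
    qpoch (q ^+ (3 * n).+1)^-1 q k != 0].
  move=> /denL; rewrite !qpochs_cons !qpochs_nil mulr1 !mulf_eq0 !negb_or.
  by move=> /and5P.
have [hP1 hP2] : qpoch (x ^+ 2 / q) q l != 0 /\ qpoch (- qh^-1) q l != 0.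
  move: denP; rewrite !qpochs_cons qpochs_nil mulr1 mulf_eq0 negb_or.
  by move=> /andP.
have [hI1 hI2 hI3] : [/\ qpoch q q l != 0, qpoch (x / q) q l != 0 &
    qpoch (x ^+ 2 / q ^+ 2 * q ^+ l.+1) q l != 0].
  have := denI l (leqnn l); rewrite !qpochs_cons qpochs_nil mulr1 !mulf_eq0.
  by rewrite !negb_or => /and3P.
have hq j : (0 < j <= l)%N -> 1 - q ^+ j != 0.
  by case: j => // j jl; move/qpoch_neq0P: hI1 => /(_ j jl); rewrite -exprS.
(* The exponent 0 is [denW], the exponents 1 to [l] come from [(x^2 / q; q)_l], and those from [l+1]
   to [2l] from [(x^2 q^(l-1); q)_l]. *)
have ha j : (j <= l.*2)%N -> 1 - x ^+ 2 / q ^+ 2 * q ^+ j != 0.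
  case: j => [_|j jl]; first by rewrite mulr1.
  have [jl'|lj] := ltnP j l.
    move/qpoch_neq0P: hP1 => /(_ j jl'); rewrite (exprS q j).
    by rewrite [X in 1 - X](_ : _ = x ^+ 2 / q ^+ 2 * (q * q ^+ j)) //; field.
  move/qpoch_neq0P: hI3 => /(_ (j - l)%N); rewrite -mulrA -exprD addSn subnKC //.
  by apply; rewrite ltn_subLR // addnn.
(* Up to [2n+1], [1 - y^2 = (1 - y) (1 + y)] reduces the even exponents to [(q, -q; q)_n] and the
   odd ones to [(q^(3/2), -q^(3/2); q)_n]. The factors of [(q^(-1-3n); q)_n] cover [2n+2] to
   [3n+1]. *)
have hroot j : (1 < j <= (3 * n).+1)%N -> 1 - q ^+ j != 0.
  move=> hj; have [jn|nj] := leqP j (2 * n).+1.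
    have sqr (y : F) : 1 - y != 0 -> 1 + y != 0 -> 1 - y ^+ 2 != 0.
      by move=> h1 h2; rewrite -{1}(expr1n _ 2) subr_sqr mulf_neq0.
    have [/qpoch_neq0P h1 /qpoch_neq0P h2 /qpoch_neq0P h3 _ _] := hL n (leqnn n).
    have [|m mn [->|->]] := even_or_odd_between n j.
    - by move: hj => /andP[-> _].
    - rewrite mulnC exprM; apply: sqr; first by rewrite exprS; apply: h1.
      by have := h2 m mn; rewrite mulNr opprK -exprS.
    have -> : q ^+ (3 + 2 * m) = (qh ^+ 3 * q ^+ m) ^+ 2.
      by rewrite exprMn exprAC qhE exprD (mulnC 2) exprM.
    apply: sqr; first exact: h3.
    by move/qpoch_neq0P: denA => /(_ m mn); rewrite mulNr opprK.
  have [_ _ _ _ /qpoch_neq0P h] := hL n (leqnn n).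
  apply: contra (h ((3 * n).+1 - j)%N _); last by clear -hj nj; lia.
  rewrite !subr_eq0 => /eqP q1.
  have {1}-> : (3 * n).+1 = ((3 * n).+1 - j + j)%N by clear -hj; lia.
  by rewrite exprD -q1 mulr1 mulVf.
(* [w i] is the weight of [i] in the expansion, [t i k] the summand of the cubic sum at [q^i x]. *)
pose w i := (- (q ^+ l / qh)) ^+ i *
    ((1 - x ^+ 2 / q ^+ 2 * q ^+ i.*2) / (1 - x ^+ 2 / q ^+ 2)) *
    ((qpoch (q ^+ l)^-1 q i * qpoch x q i * qpoch (x ^+ 2 / q ^+ 2) q i) /
     (qpoch q q i * qpoch (x / q) q i * qpoch (x ^+ 2 / q ^+ 2 * q ^+ l.+1) q i)).
pose t i k := qpoch (q ^+ (3 * n))^-1 (q ^+ 3) k *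
    (qpoch (q ^+ i * x) q k * qpoch (q ^+ 2 / (q ^+ i * x)) q k) /
    (qpoch (q ^+ 2) (q ^+ 2) k * qpoch (q ^+ 3) (q ^+ 2) k *
     qpoch (q ^+ (3 * n).+1)^-1 q k) * q ^+ k.
set P := qpoch (x / q) q l * _ / _.
transitivity (\sum_(0 <= k < n.+1) \sum_(0 <= i < l.+1) P * (w i * t i k)).
  apply: eq_big_nat => k /andP[_]; rewrite ltnS => kn.
  have [h1 h2 h3 h4 h5] := hL k kn.
  have h6 := qpoch_neq0W kn denA.
  have := qpoch_expansion _ _ _ _ _ qhE h0 x_neq0 hq ha hI2 (denB k kn) hP2 h4.
  rewrite -/P => ex.
  (* The inserted factor [(- q^(3/2); q)_k] completes the denominator to base [q^2] and the
     remaining quotient to the value of the expansion. *)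
  transitivity (qpoch (q ^+ (3 * n))^-1 (q ^+ 3) k * q ^+ k /
     (qpoch q q k * qpoch (- q) q k *
      (qpoch (qh ^+ 3) q k * qpoch (- qh ^+ 3) q k) *
      qpoch (q ^+ (3 * n).+1)^-1 q k) *
     (qpoch x q k * qpoch (q ^+ 2 / (q ^+ l * x)) q k *
     qpoch (- qh ^+ 3) q k / qpoch (- (qh ^+ 3 / q ^+ l)) q k)).
    move: h1 h2 h3 h4 h5 h6.
    move: (qpoch q q k) (qpoch (- q) q k) (qpoch (qh ^+ 3) q k)
      (qpoch (- (qh ^+ 3 / q ^+ l)) q k) (qpoch (q ^+ (3 * n).+1)^-1 q k)
      (qpoch (- qh ^+ 3) q k) (q ^+ (3 * n))^-1.
    move=> d1 d2 d3 d4 d5 d6 N h1 h2 h3 h4 h5 h6.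
    by field; rewrite h1 h2 h3 h4 h5 h6.
  rewrite -ex !qpoch_opp -[qh ^+ 3 ^+ 2]exprM (mulnC 3 2) (exprM qh) qhE.
  rewrite !mulr_sumr.
  by apply: eq_bigr => i _; rewrite -/(w i) /t; move: (w i) => W; ring.
rewrite exchange_big_nat /= mulr_sumr; apply: eq_bigr => i _.
have xi0 : q ^+ i * x != 0 by rewrite mulf_neq0.
rewrite -!mulr_sumr; congr (_ * _); rewrite /w; congr (_ * _).
  by rewrite !mulrA.
exact: sum_cubic.
Qed.

End QPochhammerSums.

(** * Specialization of rational functions *)

Section Specialization.
Context {F : numFieldType}.
Implicit Types (f g : F -> F) (s : F -> seq F) (t : F) (d p : {poly F}).

(** Nothing is asked of [f] where [d] vanishes, so the values that total division gives at poles do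
    no harm. *)
Definition regular_at t0 f := exists p d,
  d.[t0] != 0 /\ forall t, d.[t] != 0 -> f t = p.[t] / d.[t].

(** The finite exceptional set is enclosed in the roots of a nonzero polynomial, so that conjunction
    becomes a product of polynomials. *)
Definition generically (P : F -> Prop) :=
  exists2 d, d != 0 & forall t, d.[t] != 0 -> P t.

Lemma generically_and {P Q : F -> Prop} :
  generically P -> generically Q -> generically (fun t => P t /\ Q t).
Proof.
move=> [d d0 hd] [e e0 he]; exists (d * e); first by rewrite mulf_neq0.
by move=> t; rewrite hornerM mulf_eq0 negb_or => /andP[/hd ? /he ?].
Qed.

Lemma generically_forall n (P : nat -> F -> Prop) :
  (forall k, (k < n)%N -> generically (P k)) ->
  generically (fun t => forall k, (k < n)%N -> P k t).
Proof.
elim: n => [|n IHn] h; first by exists 1; rewrite ?oner_eq0.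
have [d d0 hd] := generically_and (IHn (fun k kn => h k (ltnW kn))) (h n (ltnSn n)).
exists d => // t /hd[h1 h2] k; rewrite ltnS leq_eqVlt => /predU1P[->//|].
exact: h1.
Qed.

(** In characteristic zero the integers below [size p] are distinct roots, too many for a nonzero
    [p]. *)
Lemma poly_eq0_of_horner p : (forall t, p.[t] = 0) -> p = 0.
Proof.
move=> p0; apply: (@roots_geq_poly_eq0 _ _ [seq k%:R | k <- iota 0 (size p)]).
- by apply/allP => t _; rewrite /root p0.
- by rewrite map_inj_uniq ?iota_uniq // => i j /eqP; rewrite eqr_nat => /eqP.
- by rewrite size_map size_iota.
Qed.

Lemma regular_at_neq0 t0 f :
  regular_at t0 f -> f t0 != 0 -> generically (fun t => f t != 0).
Proof.
move=> [p [d [d0 h]]]; rewrite h // => pd0; exists (p * d).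
  apply: contraNneq pd0 => /(congr1 (horner^~ t0)).
  rewrite hornerM horner0 => /eqP; rewrite mulf_eq0 (negPf d0) orbF => /eqP->.
  by rewrite mul0r.
move=> t; rewrite hornerM mulf_eq0 negb_or => /andP[pt dt].
by rewrite h // mulf_neq0 ?invr_eq0.
Qed.

(** The cross-multiplied difference times [d d' e] vanishes everywhere, hence is the zero
    polynomial; the nonzero [d], [d'], [e] cancel, and the rest is evaluated at [t0]. *)
Lemma regular_at_eq t0 f g : regular_at t0 f -> regular_at t0 g ->
  generically (fun t => f t = g t) -> f t0 = g t0.
Proof.
move=> [p [d [d0 hf]]] [p' [d' [d'0 hg]]] [e e0 h].
have nz (u : {poly F}) : u.[t0] != 0 -> u != 0.
  by apply: contraNneq => ->; rewrite horner0.
have : (p * d' - p' * d) * (d * d' * e) = 0.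
  apply: poly_eq0_of_horner => t; rewrite !(hornerM, hornerD, hornerN).
  have [->|dt] := eqVneq d.[t] 0; first by rewrite !(mul0r, mulr0).
  have [->|d't] := eqVneq d'.[t] 0; first by rewrite !(mul0r, mulr0).
  have [->|et] := eqVneq e.[t] 0; first by rewrite !(mul0r, mulr0).
  have := h t et; rewrite hf // hg // => /eqP; rewrite eqr_div // => /eqP->.
  by rewrite subrr mul0r.
move/eqP; rewrite !mulf_eq0 (negPf e0) (negPf (nz _ d0)) (negPf (nz _ d'0)) !orbF.
move=> /eqP/(congr1 (horner^~ t0)).
rewrite horner0 !(hornerM, hornerD, hornerN) => /eqP; rewrite subr_eq0 => /eqP E.
by rewrite hf // hg //; apply/eqP; rewrite eqr_div // E.
Qed.

Lemma regular_at_cst t0 c : regular_at t0 (fun=> c).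
Proof.
by exists c%:P, 1; split=> [|t _]; rewrite !hornerE ?oner_eq0 ?divr1.
Qed.

Lemma regular_at_id t0 : regular_at t0 id.
Proof. by exists 'X, 1; split=> [|t _]; rewrite !hornerE ?oner_eq0 ?divr1. Qed.

Lemma regular_atD {t0 f g} : regular_at t0 f -> regular_at t0 g ->
  regular_at t0 (fun t => f t + g t).
Proof.
move=> [p [d [d0 hf]]] [p' [d' [d'0 hg]]]; exists (p * d' + p' * d), (d * d').
split=> [|t]; first by rewrite hornerM mulf_neq0.
rewrite !hornerE mulf_eq0 negb_or => /andP[dt d't]; by rewrite hf // hg // addf_div.
Qed.

Lemma regular_atM {t0 f g} : regular_at t0 f -> regular_at t0 g ->
  regular_at t0 (fun t => f t * g t).
Proof.
move=> [p [d [d0 hf]]] [p' [d' [d'0 hg]]]; exists (p * p'), (d * d').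
split=> [|t]; first by rewrite hornerM mulf_neq0.
rewrite !hornerE mulf_eq0 negb_or => /andP[dt d't]; by rewrite hf // hg // mulf_div.
Qed.

Lemma regular_atN {t0 f} : regular_at t0 f -> regular_at t0 (fun t => - f t).
Proof.
move=> [p [d [d0 hf]]]; exists (- p), d; split=> // t dt.
by rewrite hf // !hornerE mulNr.
Qed.

Lemma regular_atV {t0 f} :
  f t0 != 0 -> regular_at t0 f -> regular_at t0 (fun t => (f t)^-1).
Proof.
move=> f0 [p [d [d0 hf]]]; move: f0; rewrite hf // mulf_eq0 negb_or => /andP[p0 _].
(* The extra factor [d] excludes the roots of [d], where [f] is unknown. *)
exists (d * d), (p * d); split=> [|t]; first by rewrite hornerM mulf_neq0.
rewrite !hornerE mulf_eq0 negb_or => /andP[pt dt].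
by rewrite hf // invf_div -mulf_div divff ?mulr1.
Qed.

Lemma regular_atX {t0 f} n : regular_at t0 f -> regular_at t0 (fun t => f t ^+ n).
Proof.
move=> hf; elim: n => [|n IHn]; first exact: regular_at_cst.
have [p [d [d0 h]]] := regular_atM hf IHn.
by exists p, d; split=> // t /h <-; rewrite exprS.
Qed.

Lemma regular_atXz t0 f (z : int) :
  f t0 != 0 -> regular_at t0 f -> regular_at t0 (fun t => f t ^ z).
Proof.
move=> f0 hf; case: z => n; first exact: regular_atX.
by apply: regular_atV; [rewrite expf_neq0|exact: regular_atX].
Qed.

Lemma regular_at_sum t0 n (f : nat -> F -> F) :
  (forall i, (i < n)%N -> regular_at t0 (f i)) ->
  regular_at t0 (fun t => \sum_(0 <= i < n) f i t).
Proof.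
elim: n => [|n IHn] h.
  have [p [d [d0 E]]] := regular_at_cst t0 0.
  by exists p, d; split=> // t /E<-; rewrite big_geq.
have [p [d [d0 E]]] :=
  regular_atD (IHn (fun k kn => h k (ltnW kn))) (h n (ltnSn n)).
by exists p, d; split=> // t /E<-; rewrite big_nat_recr.
Qed.

Lemma regular_at_qpoch t0 f g n : regular_at t0 f -> regular_at t0 g ->
  regular_at t0 (fun t => qpoch (f t) (g t) n).
Proof.
move=> hf hg; elim: n => [|n IHn].
  have [p [d [d0 E]]] := regular_at_cst t0 1.
  by exists p, d; split=> // t /E<-; rewrite qpoch0.
have h := regular_atM IHn (regular_atD (regular_at_cst t0 1)
  (regular_atN (regular_atM hf (regular_atX n hg)))).
by have [p [d [d0 E]]] := h; exists p, d; split=> // t /E<-; rewrite qpochS.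
Qed.

Lemma regular_at_qpochs_nil t0 f n : regular_at t0 (fun t => qpochs [::] (f t) n).
Proof.
have [p [d [d0 E]]] := regular_at_cst t0 1.
by exists p, d; split=> // t /E<-; rewrite qpochs_nil.
Qed.

Lemma regular_at_qpochs_cons t0 f s g n :
  regular_at t0 (fun t => qpoch (f t) (g t) n) ->
  regular_at t0 (fun t => qpochs (s t) (g t) n) ->
  regular_at t0 (fun t => qpochs (f t :: s t) (g t) n).
Proof.
move=> hf hs; have [p [d [d0 E]]] := regular_atM hf hs.
by exists p, d; split=> // t /E<-; rewrite qpochs_cons.
Qed.

Lemma regular_at_qbracket t0 s s' g n :
  qpochs (s' t0) (g t0) n != 0 ->
  regular_at t0 (fun t => qpochs (s t) (g t) n) ->
  regular_at t0 (fun t => qpochs (s' t) (g t) n) ->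
  regular_at t0 (fun t => qbracket (s t) (s' t) (g t) n).
Proof. by move=> h0 hs hs'; apply: regular_atM hs (regular_atV h0 hs'). Qed.

End Specialization.

(* Goals are matched syntactically because unification would unfold [t ^+ 2]
   into a product. *)
Ltac regular := repeat
  match goal with
  | |- regular_at _ (fun _ => ?c) => exact: regular_at_cst
  | |- regular_at _ (fun t => t) => exact: regular_at_id
  | |- regular_at _ (fun t => \sum_(0 <= i < _) _) => apply: regular_at_sum => ? ?
  | |- regular_at _ (fun t => qbracket _ _ _ _) => apply: regular_at_qbracket
  | |- regular_at _ (fun t => qpochs (_ :: _) _ _) => apply: regular_at_qpochs_cons
  | |- regular_at _ (fun t => qpochs [::] _ _) => apply: regular_at_qpochs_nil
  | |- regular_at _ (fun t => qpoch _ _ _) => apply: regular_at_qpoch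
  | |- regular_at _ (fun t => _ + _) => apply: regular_atD
  | |- regular_at _ (fun t => - _) => apply: regular_atN
  | |- regular_at _ (fun t => _ * _) => apply: regular_atM
  | |- regular_at _ (fun t => _ ^+ _) => apply: regular_atX
  | |- regular_at _ (fun t => _^-1) => apply: regular_atV
  | |- regular_at _ (fun t => _ ^ _) => apply: regular_atXz
  end.

(** * Both sides as functions of [q^(1/2)] *)

Section Regularity.
Context {F : numFieldType}.
Implicit Types (t x : F) (m k l n : nat).

Lemma generically_neq0 : generically (fun t : F => t != 0).
Proof. by exists 'X => [|t]; rewrite ?polyX_eq0 ?hornerX. Qed.

(** At [t = 0] every factor is 1. *)
Lemma generically_qpoch_opp_neq0 n :
  generically (fun t : F => qpoch (- t ^+ 3) (t ^+ 2) n != 0).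
Proof.
apply: (regular_at_neq0 0); first by regular.
apply/qpoch_neq0P => j _.
by rewrite !expr0n oppr0 mul0r subr0 oner_eq0.
Qed.

(** At [t = 1] every factor is [1 - x]. *)
Lemma generically_qpoch_div_neq0 x l k : (0 < l)%N -> x != 1 ->
  generically (fun t : F => qpoch (x / t ^+ 2 ^+ k) (t ^+ 2) l != 0).
Proof.
move=> l0 x1; apply: (regular_at_neq0 1).
  by regular; rewrite !expr1n oner_eq0.
apply/qpoch_neq0P => j _.
by rewrite !expr1n divr1 mulr1 subr_eq0 eq_sym.
Qed.

Lemma regular_at_theorem5_lhs t0 l n x : t0 != 0 ->
  (forall k, (k <= n)%N ->
     qpochs [:: t0 ^+ 2; - t0 ^+ 2; t0 ^+ 3; - t0 ^ (3 - 2 * l%:Z);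
                (t0 ^+ 2) ^ (- 1 - 3 * n%:Z)] (t0 ^+ 2) k != 0) ->
  regular_at t0 (fun t => theorem5_lhs (t ^+ 2) t l n x).
Proof.
move=> t00 h; rewrite /theorem5_lhs.
have t02 : t0 ^+ 2 != 0 by rewrite expf_neq0.
apply: regular_at_sum => k kn.
by regular => //; exact: h.
Qed.

Lemma regular_at_theorem5_rhs t0 l n x : t0 != 0 -> x != 0 ->
  qpochs [:: x ^+ 2 * (t0 ^+ 2) ^ (- 1); - t0 ^ (- 1)] (t0 ^+ 2) l != 0 ->
  1 - x ^+ 2 * (t0 ^+ 2) ^ (- 2) != 0 ->
  (forall i, (i <= l)%N ->
     qpochs [:: t0 ^+ 2; x * (t0 ^+ 2) ^ (- 1);
                x ^+ 2 * (t0 ^+ 2) ^ (l%:Z - 1)] (t0 ^+ 2) i != 0) ->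
  qpochs [:: (t0 ^+ 2) ^+ 2; (t0 ^+ 2) ^+ 4] ((t0 ^+ 2) ^+ 3) n != 0 ->
  regular_at t0 (fun t => theorem5_rhs (t ^+ 2) t l n x).
Proof.
move=> t00 x0 hP hW hI hN; rewrite /theorem5_rhs.
have t02 : t0 ^+ 2 != 0 by rewrite expf_neq0.
by regular => //; exact: hI.
Qed.

End Regularity.

(** * Removal of the extra conditions by specialization *)

Theorem theorem5 (R : realType) (q qh : R[i]) (l n : nat) (x : R[i])
  (qhE : qh ^+ 2 = q)
  (q_neq0 : q != 0)
  (x_neq0 : x != 0)
  (denL : forall k : nat, (k <= n)%N ->
     qpochs [:: q; - q; qh ^+ 3; - qh ^ (3 - 2 * l%:Z);
                q ^ (- 1 - 3 * n%:Z)] q k != 0)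
  (denP : qpochs [:: x ^+ 2 * q ^ (- 1); - qh ^ (- 1)] q l != 0)
  (denW : 1 - x ^+ 2 * q ^ (- 2) != 0)
  (denI : forall i : nat, (i <= l)%N ->
     qpochs [:: q; x * q ^ (- 1); x ^+ 2 * q ^ (l%:Z - 1)] q i != 0)
  (denN : qpochs [:: q ^+ 2; q ^+ 4] (q ^+ 3) n != 0) :
  \sum_(0 <= k < n.+1)
     qpoch (q ^ (- (3 * n%:Z))) (q ^+ 3) k *
     qbracket [:: x; q ^ (2 - l%:Z) / x]
              [:: q; - q; qh ^+ 3; - qh ^ (3 - 2 * l%:Z);
                  q ^ (- 1 - 3 * n%:Z)] q k *
     q ^+ k
  = qbracket [:: x * q ^ (- 1); - (x * qh ^ (- 1))]
             [:: x ^+ 2 * q ^ (- 1); - qh ^ (- 1)] q l *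
    \sum_(0 <= i < l.+1)
       (- 1) ^+ i * qh ^ ((2 * l%:Z - 1) * i%:Z) *
       ((1 - x ^+ 2 * q ^ (2 * i%:Z - 2)) / (1 - x ^+ 2 * q ^ (- 2))) *
       qbracket [:: q ^ (- l%:Z); x; x ^+ 2 * q ^ (- 2)]
                [:: q; x * q ^ (- 1); x ^+ 2 * q ^ (l%:Z - 1)] q i *
       qbracket [:: q ^+ (2 + i) * x; q ^ (4 - i%:Z) / x]
                [:: q ^+ 2; q ^+ 4] (q ^+ 3) n.
Proof.
rewrite -[LHS]/(theorem5_lhs q qh l n x) -[RHS]/(theorem5_rhs q qh l n x).
have h0 : qh != 0 by move: q_neq0; rewrite -qhE expf_eq0.
(* The factor [1 - x^2] occurs in a denominator: for [l = 1] as the first factor of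
   [(x^2 q^(l-1); q)_1], for larger [l] as the second factor of [(x^2 / q; q)_l]. *)
have x1 : (0 < l)%N -> x != 1.
  move=> l0; apply/eqP => x1; subst x.
  have [l1|l1] := leqP l 1.
    have l1' : l = 1%N by lia.
    subst l; have := denI 1%N isT.
    rewrite !qpochs_cons !mulf_eq0 !negb_or => /and4P[_ _ /qpoch_neq0P/(_ 0%N isT)].
    by rewrite !expr1n !mulr1 subrr eqxx.
  move: denP; rewrite !qpochs_cons !mulf_eq0 !negb_or => /andP[].
  move=> /qpoch_neq0P/(_ 1%N l1).
  by rewrite expr1n mul1r mulVf // subrr eqxx.
subst q.
apply: (regular_at_eq qh (fun t => theorem5_lhs (t ^+ 2) t l n x)
  (fun t => theorem5_rhs (t ^+ 2) t l n x)).
- exact: regular_at_theorem5_lhs.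
- exact: (regular_at_theorem5_rhs _ _ _ _ h0 x_neq0 denP denW denI denN).
have q2 : qh ^+ 2 != 0 by [].
(* Each hypothesis holds at [qh] for a function regular there, hence at all but finitely many
   [t]. *)
have gL : generically (fun t : R[i] => forall k, (k < n.+1)%N ->
    qpochs [:: t ^+ 2; - t ^+ 2; t ^+ 3; - t ^ (3 - 2 * l%:Z);
               (t ^+ 2) ^ (- 1 - 3 * n%:Z)] (t ^+ 2) k != 0).
  apply: generically_forall => k kn.
  by apply: (regular_at_neq0 qh); [regular|exact: denL].
have gP : generically (fun t : R[i] =>
    qpochs [:: x ^+ 2 * (t ^+ 2) ^ (- 1); - t ^ (- 1)] (t ^+ 2) l != 0).
  by apply: (regular_at_neq0 qh) => //; regular.
have gW : generically (fun t : R[i] => 1 - x ^+ 2 * (t ^+ 2) ^ (- 2) != 0).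
  by apply: (regular_at_neq0 qh) => //; regular; rewrite ?expf_neq0.
have gI : generically (fun t : R[i] => forall i, (i < l.+1)%N ->
    qpochs [:: t ^+ 2; x * (t ^+ 2) ^ (- 1); x ^+ 2 * (t ^+ 2) ^ (l%:Z - 1)]
      (t ^+ 2) i != 0).
  apply: generically_forall => i il.
  by apply: (regular_at_neq0 qh); [regular|exact: denI].
(* For [l = 0] the product is empty; otherwise [x] differs from 1. *)
have gB : generically (fun t : R[i] => forall k, (k < n.+1)%N ->
    qpoch (x / (t ^+ 2) ^+ k.+1) (t ^+ 2) l != 0).
  apply: generically_forall => k _; have [->|l0] := posnP l.
    by exists 1 => [|t _]; rewrite ?qpoch0 oner_eq0.
  by apply: generically_qpoch_div_neq0 => //; exact: x1.
have g := generically_and generically_neq0 (generically_and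
  (generically_qpoch_opp_neq0 n) (generically_and gL (generically_and gP
  (generically_and gW (generically_and gI gB))))).
have [d d0 hd] := g; exists d => // t /hd[t0 [tA [tL [tP [tW [tI tB]]]]]].
by apply: theorem5_nondegenerate => //; rewrite expf_neq0.
Qed.
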